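(* For every $k\in\mathbb{N}$, the space $\mathcal{P}_k$ of homogeneous Clifford-valued polynomials of degree $k$ has the direct sum (Fischer) decomposition $$\mathcal{P}_k=\bigoplus_{s=0}^{k}\underline{\mathbf{x}}^{s}\,\mathcal{M}^q_{k-s}.$$
   Context: Fix $m\ge 1$ and a real number $q>0$, $q\neq 1$. Let $\mathcal{C}\ell_{0,m}$ be the real Clifford algebra with identity and generators $e_1,\dots,e_m$ satisfying $e_ie_j+e_je_i=-2\delta_{ij}$. For a multi-index $\alpha=(\alpha_1,\dots,\alpha_m)\in\mathbb{N}^m$ (with $0\in\mathbb{N}$) put $|\alpha|=\sum_i\alpha_i$. The space $\mathcal{P}_k$ is the space of $\mathcal{C}\ell_{0,m}$-valued homogeneous polynomials of degree $k$ in the commuting real variables $x_1,\dots,x_m$, i.e. $R(\underline{\mathbf{x}})=\sum_{|\alpha|=k}x_1^{\alpha_1}\cdots x_m^{\alpha_m}\, a_\alpha$ with $a_\alpha\in\mathcal{C}\ell_{0,m}$ (the variables commute with the $e_i$). The vector variable is $\underline{\mathbf{x}}=\sum_{i=1}^m x_ie_i$; $\underline{\mathbf{x}}^s$ is its $s$-th power in the Clifford product ($\underline{\mathbf{x}}^0=1$), and $\underline{\mathbf{x}}^s\mathcal{M}^q_{k-s}=\{\underline{\mathbf{x}}^sM: M\in\mathcal{M}^q_{k-s}\}$ (left multiplication). The $q$-partial derivative is $$\partial_{x_i}^q f(x_1,\dots,x_m)=\frac{f(x_1,\dots,x_{i-1},qx_i,x_{i+1},\dots,x_m)-f(x_1,\dots,x_m)}{(q-1)x_i},$$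 so on polynomials $\partial_{x_i}^q x_i^k=[k]_q x_i^{k-1}$ with $[k]_q=\frac{q^k-1}{q-1}$. The $q$-Dirac operator is $\mathcal{D}^q_{\underline{\mathbf{x}}}=-\sum_{i=1}^m e_i\partial_{x_i}^q$ (acting from the left), and $$\mathcal{M}^q_k=\{M\in\mathcal{P}_k:\mathcal{D}^q_{\underline{\mathbf{x}}}M=0\}.$$ *)

(* Defs.v *)
From HB Require Import structures.
From mathcomp Require Import all_boot all_order all_algebra.
From mathcomp Require Import mpoly ring.

Set Implicit Arguments.
Unset Strict Implicit.
Unset Printing Implicit Defensive.

Import Order.TTheory GRing.Theory Num.Theory.
Local Open Scope ring_scope.

Section SymmetricDifference.
Context (T : finType).
Implicit Types A B C : {set T}.

Definition symdiff A B : {set T} := (A :\: B) :|: (B :\: A).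

Lemma in_symdiff A B x : (x \in symdiff A B) = (x \in A) (+) (x \in B).
Proof. by rewrite !inE; case: (x \in A); case: (x \in B). Qed.

Lemma symdiffC A B : symdiff A B = symdiff B A.
Proof. by apply/setP=> x; rewrite !in_symdiff addbC. Qed.

Lemma symdiffA A B C : symdiff A (symdiff B C) = symdiff (symdiff A B) C.
Proof. by apply/setP=> x; rewrite !in_symdiff addbA. Qed.

Lemma symdiffK A : involutive (symdiff A).
Proof. by move=> B; apply/setP=> x; rewrite !in_symdiff addKb. Qed.

Lemma symdiff0 A : symdiff set0 A = A.
Proof. by apply/setP=> x; rewrite in_symdiff inE. Qed.

Lemma symdiffx0 A : symdiff A set0 = A.
Proof. by rewrite symdiffC symdiff0. Qed.

Lemma symdiffxx A : symdiff A A = set0.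
Proof. by apply/setP=> x; rewrite in_symdiff inE addbb. Qed.

Lemma symdiff_eq A B C : (symdiff A B == C) = (B == symdiff A C).
Proof. by apply/eqP/eqP=> [<-|->]; rewrite symdiffK. Qed.

End SymmetricDifference.

(* The Clifford algebra with m generators squaring to -1. An element is the   *)
(* family of its coordinates on the 2^m blades e_A = e_(i_1) ... e_(i_r),     *)
(* where A = {i_1 < ... < i_r}; see blade_prod.                               *)
Record clifford (R : Type) (m : nat) :=
  Clifford { clifford_coord : {ffun {set 'I_m} -> R} }.

HB.instance Definition _ R m := [isNew for @clifford_coord R m].
HB.instance Definition _ (R : eqType) m := [Equality of clifford R m by <:].
HB.instance Definition _ (R : choiceType) m := [Choice of clifford R m by <:].

Section CliffordAlgebra.
Context (R : comNzRingType) (m : nat).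
Implicit Types (A B C : {set 'I_m}) (x y z : clifford R m) (a b : R).

Local Notation coord := (@clifford_coord R m).

Lemma cliffordP x y : (forall A, coord x A = coord y A) -> x = y.
Proof. by move=> e; apply/val_inj/ffunP. Qed.

Definition clifford_zero : clifford R m := Clifford 0.
Definition clifford_opp x := Clifford (- coord x).
Definition clifford_add x y := Clifford (coord x + coord y).
Definition clifford_scale a x := Clifford [ffun A => a * coord x A].

Fact clifford_addA : associative clifford_add.
Proof. by move=> x y z; apply: val_inj; exact: addrA. Qed.
Fact clifford_addC : commutative clifford_add.
Proof. by move=> x y; apply: val_inj; exact: addrC. Qed.
Fact clifford_add0 : left_id clifford_zero clifford_add.
Proof. by move=> x; apply: val_inj; exact: add0r. Qed.
Fact clifford_addN : left_inverse clifford_zero clifford_opp clifford_add.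
Proof. by move=> x; apply: val_inj; exact: addNr. Qed.

HB.instance Definition _ := GRing.isZmodule.Build (clifford R m)
  clifford_addA clifford_addC clifford_add0 clifford_addN.

Fact clifford_scaleA a b x :
  clifford_scale a (clifford_scale b x) = clifford_scale (a * b) x.
Proof. by apply: cliffordP => A; rewrite !ffunE mulrA. Qed.
Fact clifford_scale1 : left_id 1 clifford_scale.
Proof. move=> x; by apply: cliffordP => A; rewrite !ffunE mul1r. Qed.
Fact clifford_scaleDr : right_distributive clifford_scale +%R.
Proof. move=> a x y; by apply: cliffordP => A; rewrite !ffunE mulrDr. Qed.
Fact clifford_scaleDl x : {morph clifford_scale^~ x : a b / a + b}.
Proof. move=> a b; by apply: cliffordP => A; rewrite !ffunE mulrDl. Qed.

HB.instance Definition _ := GRing.Zmodule_isLmodule.Build R (clifford R m)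
  clifford_scaleA clifford_scale1 clifford_scaleDr clifford_scaleDl.

Lemma coordD x y A : coord (x + y) A = coord x A + coord y A.
Proof. by rewrite ffunE. Qed.
Lemma coordZ a x A : coord (a *: x) A = a * coord x A.
Proof. by rewrite ffunE. Qed.

(* e_A e_B = blade_sign A B e_(symdiff A B): moving the e_b of e_B into place *)
(* gives one factor -1 for each a in A with b < a (anticommutation), and one  *)
(* more if b is in A (e_b ^ 2 = -1).                                          *)
Definition blade_sign A B : R := \prod_(a in A) \prod_(b in B | (b <= a)%N) -1.

Definition clifford_mul x y : clifford R m :=
  Clifford [ffun C => \sum_A \sum_(B | symdiff A B == C)
                        blade_sign A B * (coord x A * coord y B)].

Definition blade A : clifford R m := Clifford [ffun B => (B == A)%:R].

Lemma blade_sign_symdiffl A B C :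
  blade_sign (symdiff A B) C = blade_sign A C * blade_sign B C.
Proof.
rewrite /blade_sign [LHS]big_mkcond [X in X * _]big_mkcond [X in _ * X]big_mkcond.
rewrite -big_split /=.
apply: eq_bigr => a _; rewrite in_symdiff.
case: (a \in A); case: (a \in B); rewrite /= ?mulr1 ?mul1r //.
by rewrite -big_split big1 //= => b _; rewrite mulrNN mulr1.
Qed.

Lemma blade_sign_symdiffr A B C :
  blade_sign A (symdiff B C) = blade_sign A B * blade_sign A C.
Proof.
rewrite /blade_sign -big_split /=; apply: eq_bigr => a _.
rewrite [LHS]big_mkcond [X in X * _]big_mkcond [X in _ * X]big_mkcond -big_split /=.
apply: eq_bigr => b _; rewrite in_symdiff.
by case: (b \in B); case: (b \in C); case: (b <= a)%N;
   rewrite /= ?mulrNN ?mulr1 ?mul1r.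
Qed.

Lemma clifford_mulE x y C : coord (clifford_mul x y) C =
  \sum_A blade_sign A (symdiff A C) * (coord x A * coord y (symdiff A C)).
Proof.
rewrite ffunE; apply: eq_bigr => A _.
by rewrite (big_pred1 (symdiff A C)) // => B; rewrite symdiff_eq.
Qed.

Fact clifford_mulA : associative clifford_mul.
Proof.
move=> x y z; apply: cliffordP => D; rewrite !clifford_mulE.
under [RHS]eq_bigr => C _ do rewrite clifford_mulE mulr_suml mulr_sumr.
rewrite exchange_big /=; apply: eq_bigr => A _.
rewrite clifford_mulE !mulr_sumr [RHS](reindex_inj (inv_inj (symdiffK A))) /=.
apply: eq_bigr => B _; rewrite symdiffK.
have -> : symdiff (symdiff A B) D = symdiff B (symdiff A D).
  by rewrite symdiffA [symdiff B A]symdiffC.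
set E := symdiff B (symdiff A D).
have -> : symdiff A D = symdiff B E by rewrite symdiffK.
rewrite blade_sign_symdiffl blade_sign_symdiffr; ring.
Qed.

Lemma bladeE A B : coord (blade A) B = (B == A)%:R.
Proof. by rewrite ffunE. Qed.

Lemma coord_blade_mul A x C : coord (clifford_mul (blade A) x) C =
  blade_sign A (symdiff A C) * coord x (symdiff A C).
Proof.
rewrite clifford_mulE (bigD1 A) //= big1 ?addr0; last first.
  by move=> B /negPf nBA; rewrite bladeE nBA mul0r mulr0.
by rewrite bladeE eqxx mul1r.
Qed.

Lemma blade_sign0l A : blade_sign set0 A = 1.
Proof. by rewrite /blade_sign big_set0. Qed.
Lemma blade_sign0r A : blade_sign A set0 = 1.
Proof. by rewrite /blade_sign big1 // => a _; rewrite big1 // => b; rewrite inE. Qed.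

Fact clifford_mul1 : left_id (blade set0) clifford_mul.
Proof.
move=> x; apply: cliffordP => C.
by rewrite coord_blade_mul symdiff0 blade_sign0l mul1r.
Qed.

Fact clifford_mulr1 : right_id (blade set0) clifford_mul.
Proof.
move=> x; apply: cliffordP => C; rewrite clifford_mulE (bigD1 C) //= big1.
  by rewrite symdiffxx addr0 blade_sign0r bladeE eqxx mulr1 mul1r.
move=> A nAC; rewrite bladeE symdiff_eq symdiffx0 eq_sym.
by rewrite (negPf nAC) !mulr0.
Qed.

Fact clifford_mulDl : left_distributive clifford_mul +%R.
Proof.
move=> x y z; apply: cliffordP => C; rewrite coordD !clifford_mulE -big_split.
by apply: eq_bigr => A _; rewrite coordD mulrDl mulrDr.
Qed.

Fact clifford_mulDr : right_distributive clifford_mul +%R.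
Proof.
move=> x y z; apply: cliffordP => C; rewrite coordD !clifford_mulE -big_split.
by apply: eq_bigr => A _; rewrite coordD !mulrDr.
Qed.

Fact clifford_1neq0 : blade set0 != 0.
Proof.
apply/eqP => /(congr1 (fun x => coord x set0)); rewrite bladeE ffunE eqxx.
by apply/eqP; rewrite oner_eq0.
Qed.

HB.instance Definition _ := GRing.Zmodule_isNzRing.Build (clifford R m)
  clifford_mulA clifford_mul1 clifford_mulr1 clifford_mulDl clifford_mulDr
  clifford_1neq0.

Fact clifford_scaleAl a x y : a *: (x * y) = a *: x * y.
Proof.
apply: cliffordP => C; rewrite coordZ !clifford_mulE mulr_sumr.
by apply: eq_bigr => A _; rewrite coordZ; ring.
Qed.

HB.instance Definition _ :=
  GRing.Lmodule_isLalgebra.Build R (clifford R m) clifford_scaleAl.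

Fact clifford_scaleAr a x y : a *: (x * y) = x * (a *: y).
Proof.
apply: cliffordP => C; rewrite coordZ !clifford_mulE mulr_sumr.
by apply: eq_bigr => A _; rewrite coordZ; ring.
Qed.

HB.instance Definition _ :=
  GRing.Lalgebra_isAlgebra.Build R (clifford R m) clifford_scaleAr.

Definition clifford_gen (i : 'I_m) : clifford R m := blade [set i].

Lemma blade_mul A B : blade A * blade B = blade_sign A B *: blade (symdiff A B).
Proof.
apply: cliffordP => C; rewrite coord_blade_mul coordZ !bladeE.
by rewrite symdiff_eq [C == _]eq_sym symdiff_eq; case: eqP => [->|_];
   rewrite ?mulr0.
Qed.

Lemma clifford_gen_anticomm i j :
  clifford_gen i * clifford_gen j + clifford_gen j * clifford_gen i =
  - ((i == j)%:R *+ 2).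
Proof.
have sgn k l : blade_sign [set k] [set l] = (-1) ^+ (l <= k)%N.
  rewrite /blade_sign big_set1 big_mkcondr big_set1.
  by case: (l <= k)%N.
rewrite !blade_mul !sgn [symdiff [set j] _]symdiffC -scalerDl.
have [->|nij] := eqVneq i j; rewrite ?leqnn.
  by rewrite symdiffxx scalerDl scaleN1r mulr2n opprD.
by case: ltngtP (nij : val i != val j) => //= _ _; rewrite ?subrr ?addNr scale0r mul0rn oppr0.
Qed.

Lemma blade_prod A : blade A = \prod_(i <- enum A) clifford_gen i.
Proof.
have : sorted ltn (map val (enum A)).
  apply: (subseq_sorted ltn_trans (s2 := map val (enum 'I_m))).
    by rewrite map_subseq // enumT filter_subseq.
  by rewrite val_enum_ord iota_ltn_sorted.
have -> : blade A = blade [set:: enum A].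
  by congr blade; apply/setP=> i; rewrite !inE mem_enum.
elim: (enum A) => [_|i s IHs] /=; first by rewrite big_nil; congr blade; apply/setP=> i; rewrite !inE.
rewrite path_sortedE; last exact: ltn_trans.
case/andP => /allP lis /IHs e; rewrite big_cons -e blade_mul.
have gt j : j \in s -> (i < j)%N by move=> js; apply/lis/map_f.
have -> : symdiff [set i] [set:: s] = [set:: i :: s].
  apply/setP => j; rewrite in_symdiff !inE; case: eqVneq => //= ->.
  by case: (boolP (i \in s)) => // /gt; rewrite ltnn.
rewrite /blade_sign big_set1 big1 ?scale1r // => j.
by rewrite inE => /andP[/gt]; rewrite ltnNge => /negPf->.
Qed.

End CliffordAlgebra.

From mathcomp Require Import classical_sets reals.
Local Open Scope classical_set_scope.
Local Open Scope ring_scope.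

Section QDirac.
Context (R : fieldType) (m : nat) (q : R).
Local Notation Cl := (clifford R m).
Implicit Types (f g : {mpoly Cl[m]}) (i : 'I_m) (a : 'X_{1..m}).

(* f(x_1, ..., q x_i, ..., x_m) *)
Definition qdilate i f : {mpoly Cl[m]} :=
  f \mPo [tuple (if j == i then q%:A else 1) *: 'X_j | j < m].

(* The quotient of f by x_i; the monomials free of x_i are dropped. *)
Definition div_var i f : {mpoly Cl[m]} :=
  \sum_(a <- msupp f | (0 < a i)%N) f@_a *: 'X_[a - U_(i)].

(* The quotient of qdilate i f - f by (q - 1) x_i; it is exact by qpartialE. *)
Definition qpartial i f : {mpoly Cl[m]} :=
  (q - 1)^-1%:A *: div_var i (qdilate i f - f).

Definition qdirac f : {mpoly Cl[m]} :=
  - \sum_(i < m) clifford_gen R i *: qpartial i f.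

Definition vector_var : {mpoly Cl[m]} := \sum_(i < m) clifford_gen R i *: 'X_i.

Lemma mpolyX_scaler a (c : Cl) f : 'X_[a] * (c *: f) = c *: ('X_[a] * f).
Proof. by rewrite -!commr_mpolyX scalerAl. Qed.

Lemma mulZZ_mpolyX (r s : R) a b :
  (r%:A *: 'X_[a]) * (s%:A *: 'X_[b]) = (r * s)%:A *: 'X_[a + b] :> {mpoly Cl[m]}.
Proof.
rewrite -scalerAl mpolyX_scaler scalerA -mpolyXD -scalerAl mul1r scalerA //.
Qed.

Lemma qdilateX i a :
  \prod_(j < m) tnth [tuple (if j == i then q%:A else 1) *: 'X_j | j < m] j ^+ a j
  = (q ^+ a i)%:A *: 'X_[a] :> {mpoly Cl[m]}.
Proof.
pose r j : R := if j == i then q else 1.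
have XE j n : (tnth [tuple (if j == i then q%:A else 1) *: 'X_j | j < m] j ^+ n
    : {mpoly Cl[m]}) = (r j ^+ n)%:A *: 'X_[U_(j) *+ n].
  elim: n => [|n IHn]; first by rewrite !expr0 scale1r scale1r mulm0n mpolyX0.
  rewrite !exprS IHn tnth_mktuple mulmS -mulZZ_mpolyX /r.
  by case: (j == i); rewrite ?(scale1r 1).
under eq_bigr do rewrite XE.
have -> : q ^+ a i = \prod_(j < m) r j ^+ a j.
  rewrite (bigD1 i) //= /r eqxx big1 ?mulr1 // => j /negPf->.
  by rewrite expr1n.
transitivity ((\prod_(j < m) r j ^+ a j)%:A
              *: 'X_[\sum_(j < m) U_(j) *+ a j] : {mpoly Cl[m]}).
  elim/big_rec3: _ => [|j x y z _ ->].
    by rewrite scale1r scale1r mpolyX0.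
  by rewrite mulZZ_mpolyX.
by rewrite -multinomUE_id.
Qed.

Lemma mcoeff_qdilate i f a : (qdilate i f)@_a = (q ^+ a i)%:A * f@_a.
Proof.
rewrite /qdilate comp_mpolyEX raddf_sum /=.
under eq_bigr do rewrite comp_mpolyX qdilateX scalerA mcoeffZ mcoeffX.
rewrite -scalerAl mul1r.
have [fa|/[dup] nfa /memN_msupp_eq0->] := boolP (a \in msupp f); last first.
  rewrite scaler0 big_seq big1 // => b fb; case: eqP => [e|_]; rewrite ?mulr0 //.
  by rewrite -e fb in nfa.
rewrite (bigD1_seq a) ?msupp_uniq //= eqxx mulr1 big1 => [|b /negPf->]; last first.
  by rewrite mulr0.
by rewrite addr0 -scalerAr mulr1.
Qed.

Lemma mcoeff_div_var i f a : (div_var i f)@_a = f@_(a + U_(i)).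
Proof.
rewrite /div_var raddf_sum /=.
under eq_bigr do rewrite mcoeffZ mcoeffX.
have subE (b : 'X_{1..m}) : (0 < b i)%N -> ((b - U_(i))%MM == a) = (b == (a + U_(i))%MM).
  move=> b0; have le : (U_(i) <= b)%MM by rewrite lep1mP -lt0n.
  by apply/eqP/eqP => [<-|->]; rewrite ?submK ?addmK.
under eq_bigr => b b0 do rewrite subE //.
set c := (a + U_(i))%MM.
have [fc|/[dup] nfc /memN_msupp_eq0->] := boolP (c \in msupp f); last first.
  rewrite big_seq_cond big1 // => b /andP[fb _].
  by case: eqP => [e|_]; rewrite ?mulr0 //; rewrite e (negPf nfc) in fb.
have c0 : (0 < c i)%N by rewrite mnmDE mnm1E eqxx addn1.
rewrite -big_filter (bigD1_seq c) ?filter_uniq ?msupp_uniq ?mem_filter ?c0 //=.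
by rewrite eqxx mulr1 big1 ?addr0 // => b /negPf->; rewrite mulr0.
Qed.

(* The q-number [a]_q occurs as (q ^+ a - 1) / (q - 1). *)
Lemma mcoeff_qpartial i f a :
  (qpartial i f)@_a =
  ((q ^+ (a i).+1 - 1) / (q - 1))%:A * f@_(a + U_(i)).
Proof.
rewrite mcoeffZ mcoeff_div_var mcoeffB mcoeff_qdilate mnmDE mnm1E eqxx addn1.
rewrite -!scalerAl !mul1r [in RHS]mulrC -scalerA scalerBl scale1r //.
Qed.

Lemma qpartialE i f : q != 1 ->
  (q - 1)%:A *: 'X_i * qpartial i f = qdilate i f - f.
Proof.
move=> q1; apply/mpolyP => a.
rewrite -scalerAl mcoeffZ -commr_mpolyX mcoeffB mcoeff_qdilate.
have [ai0|ai] := posnP (a i).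
  rewrite ai0 expr0 scale1r mul1r subrr memN_msupp_eq0 ?mulr0 //.
  rewrite (perm_mem (msuppMX _ _)); apply/mapP => -[b _ e].
  by move: ai0; rewrite e mnmDE mnm1E eqxx.
have -> : a = (U_(i) + (a - U_(i)))%MM by rewrite addmC submK // lep1mP -lt0n.
set b := (a - U_(i))%MM.
rewrite mcoeffMX mcoeff_qpartial [(b + _)%MM]addmC mnmDE mnm1E eqxx add1n.
rewrite -!scalerAl !mul1r scalerA mulrC divfK ?subr_eq0 //.
by rewrite scalerBl scale1r.
Qed.

Definition homog_polys (k : nat) : set {mpoly Cl[m]} := [set f | f \is k.-homog].

Definition qmonogenic (k : nat) : set {mpoly Cl[m]} :=
  [set f | homog_polys k f /\ qdirac f = 0].

Definition fischer_summand (k s : nat) : set {mpoly Cl[m]} :=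
  [set vector_var ^+ s * f | f in qmonogenic (k - s)].

End QDirac.

Arguments homog_polys R m k : clear implicits.
Arguments qmonogenic R m q k : clear implicits.
Arguments fischer_summand R m q k s : clear implicits.

Definition is_direct_sum (V : zmodType) (I : finType) (U : set V)
    (W : I -> set V) : Prop :=
  (forall w : {ffun I -> V}, (forall i, W i (w i)) -> U (\sum_i w i)) /\
  (forall u, U u ->
     exists! w : {ffun I -> V}, (forall i, W i (w i)) /\ u = \sum_i w i).

(* Main.v *)
Require Import Defs.
From HB Require Import structures.
From mathcomp Require Import all_boot all_order all_algebra.
From mathcomp Require Import mpoly.
From mathcomp Require Import classical_sets reals.

Set Implicit Arguments.
Unset Strict Implicit.
Unset Printing Implicit Defensive.

Import Order.TTheory GRing.Theory Num.Theory.
Local Open Scope ring_scope.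

(** Let x be the vector variable and D the q-Dirac operator. On Clifford-valued
    polynomials consider the Fischer bilinear form
      <f, g> = sum over exponents a of [a]_q! (f_a . g_a),
    where [a]_q! is the product of the q-factorials of the entries of a and
    the dot is the standard Euclidean product of blade coordinates. The weights
    make multiplication by x_i adjoint to the q-derivative in x_i, and each
    generator e_i is skew for the dot product, so multiplication by x is
    adjoint to D ([fischer_adjoint]). For q > 0 every q-number [n]_q with
    n > 0 is positive, so the form is positive definite ([fischer_definite]).

    Hence D (x f) = 0 gives <x f, x f> = <f, D (x f)> = 0, so x f = 0, and
    f = 0 because x has a leading coefficient e_i, which is invertible
    ([vector_var_lreg]). So f |-> D (x f) is an injective R-linear endomorphism
    of the homogeneous polynomials of degree k, a finite-dimensional space, and
    is therefore bijective ([homog_endo_surj]). If u is homogeneous of degree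
    k + 1, solving D (x f) = D u gives u = (u - x f) + x f with u - x f
    monogenic; conversely, in a decomposition u = M + x f with M monogenic, f
    is determined by D (x f) = D u. This is the direct sum
      P_(k+1) = M_(k+1) (+) x P_k,
    and the Fischer decomposition follows by iterating it ([fischer_exists],
    [fischer_unique]). *)

(** * The Euclidean product of blade coordinates *)

Section CliffordInnerProduct.
Context (R : comNzRingType) (m : nat).
Implicit Types (x y z : clifford R m) (i : 'I_m).

Local Notation coord := (@clifford_coord R m).

Definition clifford_dot x y : R := \sum_A coord x A * coord y A.

Lemma clifford_dotDr x y z :
  clifford_dot x (y + z) = clifford_dot x y + clifford_dot x z.
Proof.
by rewrite -big_split; apply: eq_bigr => A _; rewrite coordD mulrDr.
Qed.

Lemma clifford_dotDl x y z :
  clifford_dot (x + y) z = clifford_dot x z + clifford_dot y z.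
Proof.
by rewrite -big_split; apply: eq_bigr => A _; rewrite coordD mulrDl.
Qed.

Lemma clifford_dotZr (c : R) x y :
  clifford_dot x (c *: y) = c * clifford_dot x y.
Proof.
by rewrite mulr_sumr; apply: eq_bigr => A _; rewrite coordZ mulrCA.
Qed.

Lemma clifford_dot0l y : clifford_dot 0 y = 0.
Proof. by rewrite /clifford_dot big1 // => A _; rewrite ffunE mul0r. Qed.

Lemma clifford_dot0r x : clifford_dot x 0 = 0.
Proof. by rewrite /clifford_dot big1 // => A _; rewrite ffunE mulr0. Qed.

Lemma blade_sign_set1 i : blade_sign R [set i] [set i] = -1.
Proof. by rewrite /blade_sign big_set1 big_mkcondr big_set1 leqnn. Qed.

Lemma clifford_gen_sqr i : clifford_gen R i * clifford_gen R i = -1.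
Proof. by rewrite blade_mul symdiffxx blade_sign_set1; apply: scaleN1r. Qed.

(** Multiplication by e_i permutes the blades up to sign, so it is orthogonal
    for the dot product; as its square is -1, it is skew. *)
Lemma clifford_dot_gen i x y :
  clifford_dot (clifford_gen R i * x) y =
  - clifford_dot x (clifford_gen R i * y).
Proof.
rewrite /clifford_dot (reindex_inj (inv_inj (symdiffK [set i]))) -sumrN /=.
apply: eq_bigr => A _; rewrite [in LHS]coord_blade_mul symdiffK.
rewrite [in RHS]coord_blade_mul blade_sign_symdiffr blade_sign_set1.
by rewrite mulN1r mulNr mulrN opprK mulrCA mulrA.
Qed.

End CliffordInnerProduct.

(** * The vector variable *)

Section VectorVariable.
Context (R : fieldType) (m : nat).
Local Notation Cl := (clifford R m).
Local Notation xvar := (vector_var R m).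
Implicit Types (f g : {mpoly Cl[m]}) (i : 'I_m) (a b : 'X_{1..m}).

Lemma vector_var_mul f :
  xvar * f = \sum_(i < m) clifford_gen R i *: (f * 'X_i).
Proof.
rewrite mulr_suml; apply: eq_bigr => i _.
by rewrite -scalerAl commr_mpolyX.
Qed.

Lemma vector_var_mulZ (c : R) f : xvar * (c%:A *: f) = c%:A *: (xvar * f).
Proof.
rewrite !vector_var_mul scaler_sumr; apply: eq_bigr => i _.
by rewrite -scalerAl !scalerA -scalerAr mulr1 mulr_algl.
Qed.

Lemma vector_var_homog : xvar \is 1.-homog.
Proof.
apply: rpred_sum => i _; apply: dhomogZ; rewrite dhomogX.
by apply/eqP; exact: mdeg1.
Qed.

Lemma mcoeff_vector_var i : (xvar)@_U_(i) = clifford_gen R i.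
Proof.
rewrite raddf_sum /= (bigD1 i) //= mcoeffZ mcoeffX eqxx mulr1 big1 ?addr0 //.
move=> j nji; rewrite mcoeffZ mcoeffX.
suff /negPf-> : U_(j)%MM != U_(i)%MM :> 'X_{1..m} by rewrite mulr0.
apply: contra nji => /eqP/(congr1 (fun a : 'X_{1..m} => a i)).
by rewrite !mnm1E eqxx; case: eqP.
Qed.

(** The leading monomial of x has degree one, so it is some x_i with
    coefficient e_i. As e_i ^ 2 = -1, this leading coefficient is regular. *)
Lemma vector_var_lreg : (0 < m)%N -> GRing.lreg xvar.
Proof.
have gen_reg i : GRing.lreg (clifford_gen R i).
  move=> y z /(congr1 ( *%R (clifford_gen R i))).
  by rewrite !mulrA clifford_gen_sqr !mulN1r => /oppr_inj.
move=> m0; have x0 : xvar != 0.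
  apply/eqP => /(congr1 (mcoeff U_(Ordinal m0))).
  by rewrite mcoeff_vector_var mcoeff0; apply/eqP/lreg_neq0.
apply: lreg_mleadc.
have a_in := mlead_supp x0.
have /eqP/mdeg1P[i /eqP ai] := dhomog_mf vector_var_homog a_in.
by rewrite ai mcoeff_vector_var.
Qed.

Lemma vector_var_mul_homog k f : f \is k.-homog -> xvar * f \is k.+1.-homog.
Proof.
by move=> hf; rewrite -add1n; apply: dhomogM => //; apply: vector_var_homog.
Qed.

End VectorVariable.

(** * The q-Dirac operator and the Fischer form *)

Section QDiracOperator.
Context (R : fieldType) (m : nat) (q : R).
Local Notation Cl := (clifford R m).
Local Notation xvar := (vector_var R m).
Local Notation D := (@qdirac R m q).
Implicit Types (f g : {mpoly Cl[m]}) (i : 'I_m) (a b : 'X_{1..m}).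

Definition qnumber (n : nat) : R := (q ^+ n - 1) / (q - 1).

Lemma mcoeff_qdirac f a :
  (D f)@_a =
  - \sum_(i < m) qnumber (a i).+1 *: (clifford_gen R i * f@_(a + U_(i))).
Proof.
rewrite mcoeffN raddf_sum /=; congr (- _); apply: eq_bigr => i _.
by rewrite mcoeffZ mcoeff_qpartial mulr_algl scalerAr.
Qed.

Lemma qdiracD f g : D (f + g) = D f + D g.
Proof.
(* Abstracting D keeps unification from unfolding it while rewriting. *)
move: mcoeff_qdirac; move: (D) => T TE; apply/mpolyP => a.
rewrite (mcoeffD a (T f)) !TE -opprD -big_split /=; congr (- _).
by apply: eq_bigr => i _; rewrite mcoeffD mulrDr scalerDr.
Qed.

Lemma qdiracZ (c : R) f : D (c%:A *: f) = c%:A *: D f.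
Proof.
move: mcoeff_qdirac; move: (D) => T TE; apply/mpolyP => a.
rewrite (mcoeffZ _ (T f)) !TE mulr_algl.
rewrite scalerN scaler_sumr; congr (- _); apply: eq_bigr => i _.
by rewrite mcoeffZ mulr_algl -scalerAr !scalerA mulrC.
Qed.

Lemma qdirac0 : D 0 = 0.
Proof.
move: qdiracD; move: (D) => T TD.
by apply: (addrI (T 0)); rewrite -TD !addr0.
Qed.

Lemma qdiracB f g : D (f - g) = D f - D g.
Proof.
move: qdiracD; move: (D) => T TD.
by apply: (addIr (T g)); rewrite -TD !subrK.
Qed.

Lemma qdirac_homog k f : f \is k.+1.-homog -> D f \is k.-homog.
Proof.
move=> hf; apply/dhomogP => a; rewrite mcoeff_msupp; apply: contra_neq_eq.
move=> ak; rewrite mcoeff_qdirac big1 ?oppr0 // => i _.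
rewrite (dhomog_nemf_coeff hf) ?mulr0 ?scaler0 //.
by rewrite /= mdegD mdeg1 addn1 eqSS.
Qed.

Lemma qdirac_homog0 f : f \is 0.-homog -> D f = 0.
Proof.
move=> hf; apply/mpolyP => a; rewrite mcoeff_qdirac mcoeff0.
rewrite big1 ?oppr0 // => i _.
rewrite (dhomog_nemf_coeff hf) ?mulr0 ?scaler0 //.
by rewrite /= mdegD mdeg1 addn1.
Qed.

Definition qfact a : R := \prod_(i < m) \prod_(n < a i) qnumber n.+1.

Lemma qfactD1 a i : qfact (a + U_(i)) = qnumber (a i).+1 * qfact a.
Proof.
rewrite /qfact (bigD1 i) //= [in RHS](bigD1 i) //= mnmDE mnm1E eqxx addn1.
rewrite big_ord_recr /= -mulrA mulrCA; congr (_ * (_ * _)).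
by apply: eq_bigr => j /negPf nji; rewrite mnmDE mnm1E eq_sym nji addn0.
Qed.

(** The sum runs over the support of f only, so that multiplying f by a
    monomial amounts to a shift of the index. *)
Definition fischer f g : R :=
  \sum_(a <- msupp f) qfact a * clifford_dot f@_a g@_a.

(** Two polynomials with different supports can be compared termwise after
    their forms are written over a common index sequence. *)
Lemma fischer_widen (s : seq 'X_{1..m}) f g :
    uniq s -> {subset msupp f <= s} ->
  fischer f g = \sum_(a <- s) qfact a * clifford_dot f@_a g@_a.
Proof.
move=> us fs; rewrite [RHS](bigID (fun a => a \in msupp f)) /=.
rewrite [X in _ + X]big1 => [|a af]; last first.
  by rewrite (memN_msupp_eq0 af) clifford_dot0l mulr0.
rewrite addr0 -big_filter; apply/perm_big/uniq_perm => //.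
  exact: filter_uniq.
move=> a; rewrite mem_filter andb_idr //; exact: fs.
Qed.

Lemma fischer0l g : fischer 0 g = 0.
Proof. by rewrite /fischer msupp0 big_nil. Qed.

Lemma fischerDl f g h : fischer (f + g) h = fischer f h + fischer g h.
Proof.
pose s := undup (msupp f ++ msupp g); have us : uniq s := undup_uniq _.
rewrite !(@fischer_widen s) // -?big_split => [|a|a|a].
- by apply: eq_bigr => a _; rewrite mcoeffD clifford_dotDl mulrDr.
- by rewrite mem_undup mem_cat orbC => ->.
- by rewrite mem_undup mem_cat => ->.
- by rewrite mem_undup; apply: msuppD_le.
Qed.

Lemma fischer_gen i f g :
  fischer (clifford_gen R i *: f) g = - fischer f (clifford_gen R i *: g).
Proof.
rewrite (@fischer_widen (msupp f)) ?msupp_uniq //; last exact: msuppZ_le.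
rewrite -sumrN; apply: eq_bigr => a _.
by rewrite !mcoeffZ clifford_dot_gen mulrN.
Qed.

(** By [qfactD1] the factor [a_i + 1]_q comes out of the weight: it is the
    coefficient that the q-derivative in x_i puts in front of g_(a + U_i). *)
Lemma fischerMX i f g :
  fischer (f * 'X_i) g =
  \sum_(a <- msupp f)
    qfact a * (qnumber (a i).+1 * clifford_dot f@_a g@_(a + U_(i))).
Proof.
rewrite /fischer (perm_big _ (msuppMX _ _)) big_map; apply: eq_bigr => a _.
by rewrite /= mcoeffMX addmC qfactD1 -mulrA mulrCA.
Qed.

(** The skewness of e_i accounts for the minus sign in the definition of D. *)
Lemma fischer_adjoint f g : fischer (xvar * f) g = fischer f (D g).
Proof.
rewrite vector_var_mul.
rewrite (big_morph (fischer^~ g) (fun f1 f2 => fischerDl f1 f2 g) (fischer0l g)).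
under eq_bigr do rewrite fischer_gen fischerMX.
rewrite sumrN exchange_big -sumrN; apply: eq_bigr => a _ /=.
rewrite mcoeff_qdirac -scaleN1r clifford_dotZr mulN1r mulrN; congr (- _).
rewrite (big_morph _ (clifford_dotDr f@_a) (clifford_dot0r f@_a)) mulr_sumr.
by apply: eq_bigr => i _; rewrite clifford_dotZr mcoeffZ.
Qed.

End QDiracOperator.

(** * Positivity *)

Section FischerPositivity.
Context (R : realFieldType) (m : nat) (q : R).
Local Notation Cl := (clifford (R : fieldType) m).
Local Notation xvar := (vector_var R m).
Local Notation D := (@qdirac R m q).
Implicit Types (f : {mpoly Cl[m]}) (x : Cl).
Local Notation qnumber := (qnumber q).
Local Notation qfact := (@qfact R m q).

Lemma clifford_dot_ge0 x : 0 <= clifford_dot x x.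
Proof. by apply: sumr_ge0 => A _; rewrite -expr2 sqr_ge0. Qed.

Lemma clifford_dot_eq0 x : clifford_dot x x = 0 -> x = 0.
Proof.
move=> /psumr_eq0P x0; apply: cliffordP => A; rewrite ffunE; apply/eqP.
by rewrite -sqrf_eq0 expr2 x0 // => B _; rewrite -expr2 sqr_ge0.
Qed.

Hypotheses (q_gt0 : 0 < q) (q_neq1 : q != 1).

(** [n + 1]_q = 1 + q + ... + q ^ n *)
Lemma qnumber_gt0 n : 0 < qnumber n.+1.
Proof.
rewrite /qnumber subrX1 mulrAC divff ?subr_eq0 // mul1r big_ord_recl expr0.
by rewrite ltr_pwDl // sumr_ge0 // => i _; rewrite exprn_ge0 // ltW.
Qed.

Lemma fischer_definite f : fischer q f f = 0 -> f = 0.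
Proof.
have qfact_gt0 a : 0 < qfact a.
  by apply: prodr_gt0 => i _; apply: prodr_gt0 => n _; apply: qnumber_gt0.
move/eqP; rewrite psumr_eq0 => [/allP f0|a _]; last first.
  by rewrite mulr_ge0 ?clifford_dot_ge0 // ltW.
apply/eqP; rewrite -msupp_eq0; apply/eqP.
case def_s: (msupp f) => [//|a s].
have fa : a \in msupp f by rewrite def_s mem_head.
have := f0 _ fa; rewrite mulf_eq0 gt_eqF //= => /eqP/clifford_dot_eq0/eqP.
by rewrite (negPf (_ : f@_a != 0)) // -mcoeff_msupp.
Qed.

(** If D (x f) = 0 then <x f, x f> = <f, D (x f)> = 0, hence x f = 0. *)
Lemma qdirac_vector_var_inj f : (0 < m)%N -> D (xvar * f) = 0 -> f = 0.
Proof.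
move=> m0 Dxf; have/eqP : xvar * f = 0.
  apply: fischer_definite; rewrite fischer_adjoint Dxf /fischer big1 // => a _.
  by rewrite mcoeff0 clifford_dot0r mulr0.
by rewrite mulrI_eq0; [move/eqP | apply: vector_var_lreg].
Qed.

End FischerPositivity.

(** * Endomorphisms of the space of homogeneous polynomials *)

Section HomogeneousEndomorphism.
Context (R : fieldType) (m k : nat).
Local Notation Cl := (clifford R m).

(** The homogeneous polynomials of degree k form a finite-dimensional space
    over R, where an injective endomorphism is surjective. The proof passes
    to coordinates indexed by pairs of a monomial and a blade, because T is
    linear over the scalars of R, not over the Clifford algebra. *)
Lemma homog_endo_surj (T : {mpoly Cl[m]} -> {mpoly Cl[m]}) :
    {morph T : f g / f + g} ->
    (forall (c : R) f, T (c%:A *: f) = c%:A *: T f) ->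
    (forall f, f \is k.-homog -> T f \is k.-homog) ->
    (forall f, f \is k.-homog -> T f = 0 -> f = 0) ->
  forall g, g \is k.-homog -> exists2 f, f \is k.-homog & T f = g.
Proof.
move=> TD TZ Tk Tinj.
pose mono := {b : 'X_{1..m < k.+1} | mdeg b == k}.
pose V : vectType R := {ffun mono * {set 'I_m} -> R^o}.
pose poly_of (v : V) : {mpoly Cl[m]} :=
  \sum_(b : mono) Clifford [ffun A => v (b, A)] *: 'X_[val (val b)].
pose coord_of (f : {mpoly Cl[m]}) : V :=
  [ffun bA => clifford_coord f@_(val (val bA.1)) bA.2].
have poly_of_homog v : poly_of v \is k.-homog.
  apply: rpred_sum => b _; apply: dhomogZ; rewrite dhomogX; exact: (valP b).
have coord_ofK f : f \is k.-homog -> poly_of (coord_of f) = f.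
  move=> hf; apply/mpolyP => a; rewrite raddf_sum /=.
  have [ak|ak] := eqVneq (mdeg a) k; last first.
    rewrite (dhomog_nemf_coeff hf) // big1 // => b _.
    rewrite mcoeffZ mcoeffX; case: eqP => [ba|]; last by rewrite mulr0.
    by case/eqP: ak; rewrite -ba; apply/eqP/(valP b).
  have ltak : (mdeg a < k.+1)%N by rewrite ak.
  have aP : mdeg (BMultinom ltak) == k by apply/eqP.
  pose a' : mono := exist _ (BMultinom ltak) aP.
  rewrite (bigD1 a') //= mcoeffZ mcoeffX eqxx mulr1 big1 => [|b nba].
    by rewrite addr0; apply: cliffordP => A; rewrite !ffunE.
  rewrite mcoeffZ mcoeffX; case: eqP => [ba|]; last by rewrite mulr0.
  by case/eqP: nba; do 2! apply: val_inj.
have poly_ofK v : coord_of (poly_of v) = v.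
  apply/ffunP => -[b A]; rewrite ffunE /= raddf_sum /= (bigD1 b) //=.
  rewrite mcoeffZ mcoeffX eqxx mulr1 big1 => [|c ncb].
    by rewrite addr0 ffunE.
  rewrite mcoeffZ mcoeffX; case: eqP => [cb|]; last by rewrite mulr0.
  by case/eqP: ncb; do 2! apply: val_inj.
have poly_of_lin c u v : poly_of (c *: u + v) = c%:A *: poly_of u + poly_of v.
  rewrite scaler_sumr -big_split; apply: eq_bigr => b _ /=.
  rewrite scalerA mulr_algl -scalerDl; congr (_ *: _).
  by apply: cliffordP => A; rewrite coordD coordZ !ffunE.
have coord_of_lin c f g : coord_of (c%:A *: f + g) = c *: coord_of f + coord_of g.
  apply/ffunP => bA; rewrite !ffunE mcoeffD mcoeffZ mulr_algl.
  by rewrite coordD coordZ.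
have coord_of0 : coord_of 0 = 0.
  by apply/ffunP => bA; rewrite !ffunE mcoeff0 ffunE.
pose TV (v : V) : V := coord_of (T (poly_of v)).
have TV_lin : linear TV.
  by move=> c u v; rewrite /TV poly_of_lin TD TZ coord_of_lin.
pose TVmix := GRing.isLinear.Build R V V *:%R TV TV_lin.
pose TVlin : {linear V -> V} := HB.pack TV TVmix.
have TV_ker0 : lker (linfun TVlin) == 0%VS.
  apply/eqP/vspaceP => v; rewrite memv_ker lfunE memv0 /= /TV.
  apply/eqP/eqP => [Tv0|->]; last exact: (linear0 TVlin).
  have Tp0 : T (poly_of v) = 0.
    by rewrite -[LHS]coord_ofK ?Tk // Tv0 -coord_of0 coord_ofK // dhomog0.
  by rewrite -(poly_ofK v) (Tinj (poly_of v)).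
move=> g hg; exists (poly_of ((linfun TVlin)^-1%VF (coord_of g))) => //.
rewrite -[LHS]coord_ofK ?Tk // -[RHS]coord_ofK //; congr poly_of.
by have := lker0_lfunVK TV_ker0 (coord_of g); rewrite lfunE.
Qed.

End HomogeneousEndomorphism.

(** * The decomposition *)

Section FischerDecomposition.
Context (R : realFieldType) (m : nat) (q : R).
Hypotheses (m_gt0 : (0 < m)%N) (q_gt0 : 0 < q) (q_neq1 : q != 1).
Local Notation Cl := (clifford (R : fieldType) m).
Local Notation xvar := (vector_var (R : fieldType) m).
Local Notation D := (@qdirac (R : fieldType) m q).
Local Notation monogenic := (@qmonogenic (R : fieldType) m q).
Local Notation summand := (@fischer_summand (R : fieldType) m q).
Implicit Types (f u : {mpoly Cl[m]}).

Lemma monogenicB k f u : monogenic k f -> monogenic k u -> monogenic k (f - u).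
Proof.
move=> [hf Df] [hu Du]; split; first exact: rpredB.
by rewrite qdiracB Df Du subr0.
Qed.

(** Take for f the solution of D (x f) = D u. *)
Lemma fischer_step k u : u \is k.+1.-homog ->
  exists M f, [/\ monogenic k.+1 M, f \is k.-homog & u = M + xvar * f].
Proof.
move=> hu; pose T f := D (xvar * f).
have [||||f hf Dxf] :=
    @homog_endo_surj _ m k T _ _ _ _ (D u) (qdirac_homog q hu).
- by move=> f g; rewrite /T mulrDr qdiracD.
- by move=> c f; rewrite /T vector_var_mulZ qdiracZ.
- by move=> f hf; apply/qdirac_homog/vector_var_mul_homog.
- move=> f _; exact: (qdirac_vector_var_inj q_gt0 q_neq1 m_gt0).
exists (u - xvar * f), f; split; [split | exact: hf | by rewrite subrK].
  apply: rpredB; [exact: hu | exact: vector_var_mul_homog].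
by rewrite qdiracB (Dxf : D (xvar * f) = D u); apply: subrr.
Qed.

Lemma fischer_exists k u : u \is k.-homog ->
  exists w : 'I_k.+1 -> {mpoly Cl[m]},
    (forall s : 'I_k.+1, summand k s (w s)) /\ u = \sum_s w s.
Proof.
elim: k u => [|k IHk] u hu.
  exists (fun=> u); split=> [s|]; last by rewrite big_ord1.
  rewrite [s]ord1; exists u; last by rewrite expr0 mul1r.
  by split=> //; apply: qdirac_homog0.
have [M [f [HM hf ->]]] := fischer_step hu.
have [v [vP ->]] := IHk f hf.
exists (fun s => oapp (fun j => xvar * v j) M (unlift ord0 s)); split=> [s|].
  case: unliftP => [j ->|->]; last by exists M => //; rewrite expr0 mul1r.
  have [N NP Nv] := vP j; exists N; rewrite lift0; first by rewrite subSS.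
  by rewrite exprS -mulrA Nv.
rewrite [RHS]big_ord_recl unlift_none mulr_sumr; congr (_ + _).
by apply: eq_bigr => j _; rewrite liftK.
Qed.

(** Stated for the monogenic factors rather than the summands, so that the
    induction can drop a factor x. Writing the sum as M_0 + x f and applying D
    leaves D (x f) = 0, so f = 0 and then M_0 = 0. *)
Lemma fischer_unique k (M : 'I_k.+1 -> {mpoly Cl[m]}) :
    (forall s : 'I_k.+1, monogenic (k - s) (M s)) ->
    \sum_(s < k.+1) xvar ^+ s * M s = 0 ->
  forall s, M s = 0.
Proof.
elim: k M => [|k IHk] M MP.
  by rewrite big_ord1 expr0 mul1r => M0 s; rewrite [s]ord1.
rewrite big_ord_recl expr0 mul1r.
under eq_bigr do rewrite lift0 exprS -mulrA.
rewrite -mulr_sumr; set f := \sum_i _ => sum0.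
have f0 : f = 0.
  apply: (qdirac_vector_var_inj q_gt0 q_neq1 m_gt0).
  have := congr1 D sum0; rewrite qdiracD qdirac0.
  by have [_ ->] := MP ord0; rewrite add0r.
have M0 : M ord0 = 0 by move: sum0; rewrite f0 mulr0 addr0.
move=> s; case: (unliftP ord0 s) => [j|] -> //.
apply: (IHk (fun j => M (lift ord0 j))) => // i.
by have := MP (lift ord0 i); rewrite lift0 subSS.
Qed.

Lemma fischer_factors k (w : 'I_k.+1 -> {mpoly Cl[m]}) :
    (forall s : 'I_k.+1, summand k s (w s)) ->
  exists M : 'I_k.+1 -> {mpoly Cl[m]},
    forall s : 'I_k.+1, monogenic (k - s) (M s) /\ xvar ^+ s * M s = w s.
Proof.
move=> wP; have {}wP (s : 'I_k.+1) : exists N : {mpoly Cl[m]},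
    monogenic (k - s) N /\ xvar ^+ s * N = w s.
  by have [N NP Nw] := wP s; exists N.
by have [M MP] := fin_all_exists wP; exists M.
Qed.

Lemma fischer_decomposition k :
  is_direct_sum (homog_polys (R : fieldType) m k)
    (fun s : 'I_k.+1 => summand k s).
Proof.
split=> [w wP|u hu].
  apply: rpred_sum => s _; have [M [hM _] <-] := wP s.
  have := dhomogM (dhomogMn s (vector_var_homog R m)) hM.
  by rewrite mul1n subnKC // -ltnS.
have [w [wP uE]] := fischer_exists hu.
exists (finfun w); split=> [|w' [w'P u'E]].
  split=> [s|]; first by rewrite ffunE.
  by rewrite uE; apply: eq_bigr => s _; rewrite ffunE.
have [M MP] := fischer_factors wP; have [M' M'P] := fischer_factors w'P.
have MM' : forall s, M s - M' s = 0.
  apply: fischer_unique => [s|].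
    by apply: monogenicB; [have [] := MP s | have [] := M'P s].
  under eq_bigr => s _ do rewrite mulrBr (MP s).2 (M'P s).2.
  by rewrite sumrB -uE -u'E subrr.
apply/ffunP => s; rewrite ffunE -(MP s).2 -(M'P s).2.
by have /subr0_eq-> := MM' s.
Qed.

End FischerDecomposition.

Theorem mainTheorem2 (R : realType) (m : nat) (q : R) (k : nat)
    (m_gt0 : (1 <= m)%N) (q_gt0 : 0 < q) (q_neq1 : q != 1) :
  is_direct_sum (homog_polys R m k)
    (fun s : 'I_k.+1 => fischer_summand R m q k s).
Proof. exact: fischer_decomposition. Qed.
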